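(* Let $A$, $A'$ and $M$ be integers with $0<A,A'\le M$, let $r$ be a nonnegative integer and let $s$ be a positive integer. Then $$\lim_{n\to\infty}\frac{\sigma_{M,A}^{[s]}(r;n)}{\sigma_{M,A'}^{[s]}(r;n)}=1.$$
   Context: A partition $\pi$ of $n$ (written $\pi\vdash n$) is a weakly decreasing finite sequence of positive integers, called parts, with sum $n$. The frequency of a positive integer $k$ in $\pi$ is the number of times $k$ occurs as a part of $\pi$ (possibly $0$). For a positive integer $s$, $\operatorname{mex}^{[s]}(\pi)$ denotes the smallest positive integer whose frequency in $\pi$ is less than $s$. For integers $A,M$ with $0<A\le M$, a nonnegative integer $r$ and a positive integer $s$, define $$\sigma_{M,A}^{[s]}(r;n):=\sum_{\substack{\pi\vdash n\\ \operatorname{mex}^{[s]}(\pi)\equiv A \bmod M}}\big(\operatorname{mex}^{[s]}(\pi)\big)^r.$$ *)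

(* Defs.v *)
From HB Require Import structures.
From mathcomp Require Import all_boot all_order all_algebra.
From mathcomp Require Import all_classical all_reals all_analysis.

Set Implicit Arguments.
Unset Strict Implicit.
Unset Printing Implicit Defensive.

Definition is_partition (n : nat) (p : seq nat) : bool :=
  [&& sorted geq p, all (fun k => 0 < k) p & sumn p == n].

(* A partition of n has at most n parts, each at most n, so it is enough to
   search the finite type of sequences of length at most n over 'I_n.+1;
   see mem_partitions. *)
Definition partitions (n : nat) : seq (seq nat) :=
  [seq p <- [seq [seq val i | i <- t] | t : {bseq n of 'I_n.+1}]
     | is_partition n p].

Lemma partitions_uniq (n : nat) : uniq (partitions n).
Proof.
apply: filter_uniq; rewrite map_inj_uniq ?enum_uniq // => t u tu.
by apply: val_inj; exact: (inj_map val_inj).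
Qed.

Lemma size_le_sumn (p : seq nat) :
  all (fun k => 0 < k) p -> size p <= sumn p.
Proof.
elim: p => //= k p IHp /andP[k0 /IHp lep].
by rewrite -add1n leq_add.
Qed.

Lemma mem_le_sumn (p : seq nat) (k : nat) : k \in p -> k <= sumn p.
Proof.
elim: p => //= j p IHp; rewrite inE => /orP[/eqP ->|/IHp lek].
  exact: leq_addr.
exact: leq_trans lek (leq_addl _ _).
Qed.

Lemma mem_partitions (n : nat) (p : seq nat) :
  (p \in partitions n) = is_partition n p.
Proof.
rewrite mem_filter andb_idr // => /and3P[_ pos_p /eqP sum_p].
have size_p : size [seq (inord k : 'I_n.+1) | k <- p] <= n.
  by rewrite size_map -sum_p size_le_sumn.
apply/mapP; exists (Bseq size_p); rewrite ?mem_enum //=.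
rewrite -map_comp -[LHS]map_id; apply/eq_in_map => k kp /=.
by rewrite inordK // ltnS -sum_p mem_le_sumn.
Qed.

(* The frequency of k in p is count_mem k p. For 0 < s the search stops within
   the range, since size p + 1 integers cannot all occur in p; see mexP. *)
Definition mex (s : nat) (p : seq nat) : nat :=
  (find (fun k => count_mem k p < s) (iota 1 (size p).+1)).+1.

Lemma mexP (s : nat) (p : seq nat) : 0 < s ->
  [/\ 0 < mex s p, count_mem (mex s p) p < s
    & forall k, 0 < k -> count_mem k p < s -> mex s p <= k].
Proof.
move=> s0; set a := fun k => count_mem k p < s.
have has_a : has a (iota 1 (size p).+1).
  apply: contraT => /hasPn no_a.
  suff: size (iota 1 (size p).+1) <= size p by rewrite size_iota ltnn.
  apply: uniq_leq_size (iota_uniq _ _) _ => k /no_a.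
  by rewrite /a -leqNgt -has_pred1 has_count; exact: leq_trans.
have lt_find : find a (iota 1 (size p).+1) < (size p).+1.
  by rewrite -[X in _ < X](size_iota 1) -has_find.
split=> //.
  by have := nth_find 0 has_a; rewrite nth_iota // add1n.
move=> [//|k] _ ak; rewrite ltnS leqNgt; apply/negP => lt_k.
have := before_find 0 lt_k.
by rewrite nth_iota ?(ltn_trans lt_k) // add1n /a ak.
Qed.

Definition sigma (M A s r n : nat) : nat :=
  \sum_(p <- partitions n | mex s p == A %[mod M]) mex s p ^ r.

(* Main.v *)
Require Import Defs.
From HB Require Import structures.
From mathcomp Require Import all_boot all_order all_algebra.
From mathcomp Require Import all_classical all_reals all_analysis.
From mathcomp Require Import zify ring lra.
Import Order.TTheory GRing.Theory Num.Theory.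
Import numFieldNormedType.Exports.

Set Implicit Arguments.
Unset Strict Implicit.
Unset Printing Implicit Defensive.

(** Write p(n) for the number of partitions of n and T(m) = m (m + 1) / 2.
    A partition has [mex] larger than m exactly when it contains s copies of
    each of 1, ..., m, and removing these copies shows that there are
    p(n - s T(m)) such partitions (lemma [count_contains]).  Hence
      #{mex = m} = p(n - s T(m-1)) - p(n - s T(m)),
    the increase of p over a block of s m consecutive arguments.

    For n >= 1 the increment d(n) = p(n) - p(n-1) counts the partitions of
    n without the part 1, and is nondecreasing: enlarge the largest part.
    So p is convex, and the average increase over a block decreases as m
    grows: #{mex = b} is at most (b / a) #{mex = a} for a < b, up to a
    boundary effect at arguments below 0 ([nmex_trunc_ratio]). Now pair
    the value A + j M of one residue class with the larger value A' + (j +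
    1) M of the other. The ratio of the two tends to 1 as j grows, so for
    every k, with a constant C independent of n,
      k sigma_A' <= (k + 1) sigma_A + C (d(n) + (n + 1)^(r + 1)),
    the last term absorbing the finitely many small j and the boundary effect
    ([sigma_compare]).

    The error term is negligible.  The M residue classes together
    account for every partition, so p(n) <= sum_A sigma_A, and the comparison
    with k = 1 makes each sigma_A at least of order p(n) minus the error.  It
    remains to see that p(n) dominates d(n) and all powers of n.  The second
    claim holds because multiplicities of 2, ..., K + 1 up to about n / K^2 can
    be chosen freely and the rest filled with ones ([npart_ge_exp]).  For the
    first, take a partition without the part 1 and having at least L distinct
    part sizes: replacing one part k by k ones, for each of its sizes k, gives
    L partitions from which it can be recovered; the partitions with fewer
    than L part sizes are polynomially few ([dpart_bound]).  Exchanging the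
    roles of A and A' gives the limit. *)

(** * Counting partitions that contain a given multiset *)

Definition npart (n : nat) : nat := size (partitions n).

Definition contains (mu p : seq nat) : bool :=
  all (fun k => count_mem k mu <= count_mem k p) mu.

Lemma containsP (mu p : seq nat) :
  reflect (forall k, count_mem k mu <= count_mem k p) (contains mu p).
Proof.
apply: (iffP allP) => [h k|h k _]; last exact: h.
have [/h//|/count_memPn -> //] := boolP (k \in mu).
Qed.

Lemma geq_total : total geq. Proof. by move=> x y /=; exact: leq_total. Qed.

Lemma geq_trans : transitive geq.
Proof. by move=> y x z /= yx zy; exact: leq_trans zy yx. Qed.

Lemma geq_anti : antisymmetric geq.
Proof. by move=> x y /= h; apply: anti_leq; rewrite andbC. Qed.

Lemma perm_partition (n m : nat) (p q : seq nat) :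
  p \in partitions n -> q \in partitions m -> perm_eq p q -> p = q.
Proof.
rewrite !mem_partitions => /and3P[sp _ _] /and3P[sq _ _].
exact: (sorted_eq geq_trans geq_anti).
Qed.

Lemma sort_partition (p : seq nat) :
  all (fun k => 0 < k) p -> sort geq p \in partitions (sumn p).
Proof.
move=> pos; rewrite mem_partitions /is_partition (sort_sorted geq_total).
by rewrite all_sort pos (perm_sumn (permEl (perm_sort _ _))) /=.
Qed.

(** Removing the parts of [mu] is a bijection onto the partitions of
    [n - sumn mu].  It is applied with [mu] the part 1, to reach [dpart]; with one
    or two parts, to count the partitions having a given part and no part 1;
    and with [s] copies of each of 1, ..., m, to compute the mex. *)
Lemma count_contains (mu : seq nat) (n : nat) : all (fun k => 0 < k) mu ->
  count (contains mu) (partitions n) =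
    if sumn mu <= n then npart (n - sumn mu) else 0.
Proof.
move=> mu_gt0; case: leqP => [mun|nmu]; last first.
  rewrite -size_filter; apply/eqP; rewrite size_eq0 -[_ == _]negbK -has_filter.
  apply/hasPn => p; rewrite mem_partitions => /and3P[_ _ /eqP sp].
  apply/negP => /containsP/count_subseqP[q /perm_to_subseq[t pqt] muq].
  move: nmu; rewrite -sp (perm_sumn pqt) sumn_cat (perm_sumn muq).
  by rewrite ltnNge leq_addr.
rewrite -size_filter /npart -[RHS](size_map (fun q => sort geq (mu ++ q))).
apply: perm_size; apply: uniq_perm.
- by rewrite filter_uniq ?partitions_uniq.
- rewrite map_inj_in_uniq ?partitions_uniq // => p q pP qP /perm_sortP h.
  apply: perm_partition pP qP _.
  rewrite -(perm_cat2l mu); apply: h.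
  + exact: geq_total.
  + exact: geq_trans.
  + exact: geq_anti.
move=> p; rewrite mem_filter; apply/andP/mapP => [[]|[q]].
  move=> /containsP/count_subseqP[q /perm_to_subseq[t pqt] muq] pn.
  have pmut : perm_eq p (mu ++ t) by rewrite (perm_trans pqt)// perm_cat2r perm_sym.
  move: (pn); rewrite mem_partitions => /and3P[_ p_gt0 /eqP sp].
  move: p_gt0 (sp); rewrite (perm_all _ pmut) (perm_sumn pmut) all_cat sumn_cat.
  move=> /andP[_ t_gt0] st.
  exists (sort geq t); first by rewrite -st addKn sort_partition.
  have pmut' : perm_eq p (sort geq (mu ++ sort geq t)).
    rewrite perm_sym perm_sort perm_sym (perm_trans pmut)// perm_cat2l.
    by rewrite perm_sym perm_sort.
  apply: perm_partition pn _ pmut'; apply: sort_partition.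
  by rewrite all_cat mu_gt0 all_sort.
rewrite mem_partitions => /and3P[sq q_gt0 /eqP sumq] ->; split.
  apply/containsP => k.
  by rewrite (permP (permEl (perm_sort _ _))) count_cat leq_addr.
have -> : n = sumn (mu ++ q) by rewrite sumn_cat sumq subnKC.
by rewrite sort_partition // all_cat mu_gt0.
Qed.

Lemma npart0 : npart 0 = 1.
Proof.
apply/eqP; rewrite eqn_leq; apply/andP; split; last first.
  by rewrite /npart -has_predT; apply/hasP; exists [::]; rewrite ?mem_partitions.
apply: (@leq_trans (size [:: ([::] : seq nat)])) => //.
apply: uniq_leq_size (partitions_uniq 0) _ => p.
rewrite mem_partitions => /and3P[_ p0 /eqP sp].
by rewrite mem_seq1 -size_eq0 -leqn0 -sp size_le_sumn.
Qed.

(** * Increments of the partition function *)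

(** With [0.-1 = 0] this gives [dpart 0 = 0] rather than p(0) = 1, which is what
    makes [dpart] monotone from 0 on. *)
Definition dpart (n : nat) : nat := npart n - npart n.-1.

Definition noones (n : nat) : seq (seq nat) := [seq p <- partitions n | 1 \notin p].

Lemma mem_noones (n : nat) (p : seq nat) :
  (p \in noones n) = (1 \notin p) && is_partition n p.
Proof. by rewrite mem_filter mem_partitions. Qed.

Lemma contains1 (k : nat) (p : seq nat) : contains [:: k] p = (k \in p).
Proof. by rewrite /contains /= eqxx andbT -has_pred1 has_count. Qed.

Lemma dpartE (n : nat) : dpart n.+1 = size (noones n.+1).
Proof.
rewrite /dpart size_filter /=.
have -> : npart n = count (contains [:: 1]) (partitions n.+1).
  by rewrite count_contains //= subSS subn0.
rewrite /npart -(count_predC (contains [:: 1])) addKn.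
by apply: eq_count => p /=; rewrite contains1.
Qed.

Lemma npartS (n : nat) : npart n <= npart n.+1.
Proof.
have -> : npart n = count (contains [:: 1]) (partitions n.+1).
  by rewrite count_contains //= subSS subn0.
exact: count_size.
Qed.

Lemma npart_le (m n : nat) : m <= n -> npart m <= npart n.
Proof. exact: (homo_leq leqnn leq_trans npartS). Qed.

Lemma npartSE (n : nat) : npart n.+1 = npart n + dpart n.+1.
Proof. by rewrite /dpart /= subnKC ?npartS. Qed.

Lemma leq_size_in (T U : eqType) (f : T -> U) (s : seq T) (t : seq U) :
  uniq s -> {in s &, injective f} -> {in s, forall x, f x \in t} ->
  size s <= size t.
Proof.
move=> us f_inj fst; rewrite -(size_map f); apply: uniq_leq_size.
  by rewrite map_inj_in_uniq.
by move=> _ /mapP[x xs ->]; exact: fst.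
Qed.

(** Adding 1 to the largest part injects the partitions of [n] without the
    part 1 into those of [n.+1]. *)
Lemma dpartS (n : nat) : dpart n <= dpart n.+1.
Proof.
case: n => [|n]; rewrite ?dpartE; first by rewrite /dpart subnn.
apply: (@leq_size_in (seq nat) (seq nat)
  (fun p => if p is k :: q then k.+1 :: q else [::])).
- by rewrite filter_uniq ?partitions_uniq.
- have nz q : q \in noones n.+1 -> q <> [::].
    by move=> qP qE; move: qP; rewrite qE mem_noones.
  by move=> [|k q] [|l t] /nz // _ /nz // _ [-> ->].
case=> [|k q]; rewrite !mem_noones //= !inE /is_partition.
rewrite /= => /and4P[k1 + /andP[k0 q0] /eqP <-].
rewrite !negb_or q0 /= addSn eqxx !andbT (_ : 1 == k.+1 = false); last first.
  by case: k k0 k1.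
move: k1; rewrite negb_or => /andP[_ ->] /=.
by case: q q0 => //= l q _ /andP[lk ->]; rewrite andbT (leq_trans lk).
Qed.

Lemma dpart_le (m n : nat) : m <= n -> dpart m <= dpart n.
Proof. exact: (homo_leq leqnn leq_trans dpartS). Qed.

(** The next two bounds are the convexity of p: the increase over [l] steps is
    at most, respectively at least, [l] times an increment taken above,
    respectively below, these steps. *)
Lemma npart_sub_le (x l y : nat) : x <= y -> npart x - npart (x - l) <= l * dpart y.
Proof.
elim: l x => [|l IHl] x xy; first by rewrite subn0 subnn.
case: x xy => [|x] xy; first by rewrite sub0n subnn.
rewrite subSS npartSE mulSn.
have := IHl x (ltnW xy); have := dpart_le xy; lia.
Qed.

Lemma npart_sub_ge (x l y : nat) :
  y <= x - l -> l * dpart y <= npart x - npart (x - l).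
Proof.
elim: l x => [|l IHl] x xy; first by rewrite mul0n.
case: x xy => [|x].
  by rewrite sub0n leqn0 => /eqP ->; rewrite /dpart subnn muln0.
rewrite subSS => xy; rewrite npartSE mulSn.
have := IHl x xy; have := dpart_le (_ : y <= x.+1); have := npart_le (leq_subr l x).
move=> h1 /(_ (leq_trans xy (leq_trans (leq_subr _ _) (leqnSn _)))); lia.
Qed.

(** * The partition function dominates its increments and all powers *)

(** Inclusion-exclusion on the parts 1 and [k]; the tests on [n] matter because
    the truncated [n - k] would count the empty partition when [n < k]. *)
Lemma count_mem_noones (n k : nat) : 1 < k ->
  count (fun p => k \in p) (noones n) =
    (if k <= n then npart (n - k) else 0) -
    (if k < n then npart (n - k.+1) else 0).
Proof.
move=> k1; have k0 : 0 < k by exact: ltnW.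
have k1F : (k == 1) = false by case: k k1 {k0} => [|[]].
have := @count_contains [:: k] n; have := @count_contains [:: 1; k] n.
rewrite /= k0 addn0 add1n => /(_ isT) <- /(_ isT) <-.
rewrite (eq_count (contains1 k)).
have -> : count (contains [:: 1; k]) (partitions n) =
    count (fun p => 1 \in p) [seq p <- partitions n | k \in p].
  rewrite count_filter; apply: eq_count => p.
  by rewrite /contains /= eqxx k1F eq_sym k1F /= andbT -!has_pred1 !has_count.
have := count_predC (fun p => 1 \in p) [seq p <- partitions n | k \in p].
rewrite size_filter => <-; rewrite addKn /noones !count_filter.
by apply: eq_count => p /=; case: (1 \in p); case: (k \in p).
Qed.

(** Pairs of a partition without the part 1 and one of its part sizes [k]
    inject into the partitions of [n] by turning one part [k] into [k] ones.
    The proof exchanges the sums, and the count for each [k] telescopes. *)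
Lemma sum_undup_noones (n : nat) :
  \sum_(p <- noones n) size (undup p) <= npart n.
Proof.
have sizeE p : p \in noones n -> size (undup p) = \sum_(2 <= k < n.+1) (k \in p).
  rewrite mem_noones => /and3P[one_p _ /andP[p0 /eqP sp]].
  transitivity (count [in p] (index_iota 2 n.+1)); last first.
    by rewrite -sum1_count big_mkcond; apply: eq_bigr => k _ /=; case: (k \in p).
  rewrite -size_filter; apply: perm_size; apply: uniq_perm.
  - exact: undup_uniq.
  - by rewrite filter_uniq ?iota_uniq.
  move=> k; rewrite mem_undup mem_filter mem_index_iota ltnS /=.
  have [kp|//] := boolP (k \in p); rewrite -sp mem_le_sumn // andbT.
  by case: k kp (allP p0 _ kp) => [|[|k]] // kp; rewrite kp in one_p.
rewrite (eq_big_seq _ sizeE) exchange_big /=.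
pose e k := if k <= n then npart (n - k) else 0.
have eS k : e k.+1 <= e k.
  rewrite /e; case: ltnP => // kn; rewrite (ltnW kn); apply: npart_le.
  by rewrite leq_sub2l.
have sumE : \sum_(2 <= k < n.+1) \sum_(p <- noones n) (k \in p) =
  \sum_(2 <= k < n.+1) (e k - e k.+1).
  apply: eq_big_nat => k /andP[k1 _].
  rewrite /e -count_mem_noones // -sum1_count [RHS]big_mkcond /=.
  by apply: eq_bigr => p _; case: (k \in p).
rewrite sumE.
have tele m : \sum_(2 <= k < m.+2) (e k - e k.+1) + e m.+2 <= e 2.
  elim: m => [|m IHm]; first by rewrite big_geq.
  rewrite big_nat_recr //=; apply: leq_trans IHm.
  by rewrite -addnA subnK.
apply: (@leq_trans (e 2)).
  case: n {sizeE sumE eS} @e tele => [|n] e tele; first by rewrite big_geq.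
  exact: leq_trans (leq_addr _ _) (tele _).
rewrite /e; by case: ifP => // _; apply: npart_le; rewrite leq_subr.
Qed.

(** Such a partition is encoded by the list of its at most [L] pairs
    (part size, multiplicity). *)
Lemma count_few_sizes (n L : nat) :
  count (fun p => size (undup p) < L) (partitions n) <= n.+1 ^ (2 * L).
Proof.
pose g (p : seq nat) : {ffun 'I_L -> 'I_n.+1 * 'I_n.+1} :=
  [ffun i : 'I_L =>
     (inord (nth 0 (undup p) i), inord (count_mem (nth 0 (undup p) i) p))].
rewrite -size_filter.
have -> : n.+1 ^ (2 * L) = size (enum {: {ffun 'I_L -> 'I_n.+1 * 'I_n.+1}}).
  by rewrite -cardT card_ffun card_prod !card_ord expnM.
apply: (@leq_size_in _ _ g).
- by rewrite filter_uniq ?partitions_uniq.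
- move=> p q; rewrite mem_filter => /andP[pL pn].
  rewrite mem_filter => /andP[qL qn] gpq.
  apply: (perm_partition pn qn).
  have mult_le u x : u \in partitions n -> count_mem x u <= n.
    rewrite mem_partitions => /and3P[_ u0 /eqP <-].
    exact: leq_trans (count_size _ _) (size_le_sumn u0).
  have part_le u i : u \in partitions n -> nth 0 (undup u) i <= n.
    rewrite mem_partitions => /and3P[_ _ /eqP <-].
    have [/(mem_nth 0)|/(nth_default 0) -> //] := ltnP i (size (undup u)).
    by rewrite mem_undup; exact: mem_le_sumn.
  (* The entry of the common code at the index of [x] in [undup u] must also
     name [x] for [v], with the same multiplicity. *)
  have half u v : u \in partitions n -> v \in partitions n ->
      size (undup u) < L -> g u = g v ->
      forall x, x \in u -> (count_mem x u = count_mem x v).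
    move=> un vn uL guv x xu.
    have xU : index x (undup u) < size (undup u) by rewrite index_mem mem_undup.
    have iL := ltn_trans xU uL.
    move/ffunP/(_ (Ordinal iL)): guv; rewrite !ffunE /=.
    move=> [/(congr1 (@nat_of_ord _)) + /(congr1 (@nat_of_ord _))].
    rewrite !inordK ?ltnS ?part_le ?mult_le //.
    by rewrite nth_index ?mem_undup // => <- ->.
  rewrite /perm_eq; apply/allP => x _; apply/eqP.
  have [xp|xp] := boolP (x \in p); first exact: half pn qn pL gpq _ xp.
  have [xq|xq] := boolP (x \in q); last by rewrite !(count_memPn _).
  exact: esym (half _ _ qn pn qL (esym gpq) _ xq).
by move=> p _; rewrite mem_enum.
Qed.

(** Each partition without the part 1 has at least [L] distinct part sizes, and
    is then counted [L] times by [sum_undup_noones], or belongs to the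
    polynomially many counted by [count_few_sizes]. *)
Lemma dpart_bound (L n : nat) :
  L * dpart n <= npart n + L * n.+1 ^ (2 * L).
Proof.
case: n => [|n]; first by rewrite /dpart subnn muln0.
rewrite dpartE -(count_predC (fun p => size (undup p) < L)) mulnDr addnC.
apply: leq_add; last first.
  rewrite leq_mul2l; apply/orP; right; apply: leq_trans (count_few_sizes _ _).
  by rewrite /noones count_filter; apply: sub_count => p /= /andP[].
apply: leq_trans (sum_undup_noones _).
rewrite -sum1_count big_distrr /= big_mkcond leq_sum // => p _.
by case: ifPn => //=; rewrite -leqNgt muln1.
Qed.

(** Choose the multiplicities of 2, ..., [K.+1] freely in 0, ..., [N] and fill up
    with ones. *)
Lemma npart_ge_exp (K N n : nat) : K * K.+1 * N <= n -> N.+1 ^ K <= npart n.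
Proof.
move=> KNn.
pose u (f : {ffun 'I_K -> 'I_N.+1}) :=
  flatten [seq nseq (f i) i.+2 | i <- enum 'I_K].
have u_gt0 f : all (fun k => 0 < k) (u f).
  apply/allP => k /flattenP[t /mapP[i _ ->]].
  by rewrite mem_nseq => /andP[_ /eqP ->].
have sum_u f : sumn (u f) <= n.
  rewrite /u sumn_flatten -map_comp sumnE big_map big_enum /=.
  apply: leq_trans KNn; rewrite -mulnA -[X in X * _]card_ord -sum_nat_const.
  apply: leq_sum => i _; rewrite sumn_nseq leq_mul //; last by rewrite -ltnS.
  exact: ltn_ord.
have count_u f (i : 'I_K) : count_mem i.+2 (u f) = f i.
  rewrite /u count_flatten -map_comp sumnE big_map big_enum /= (bigD1 i) //=.
  rewrite count_nseq /= eqxx mul1n big1 ?addn0 // => j ji.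
  by rewrite count_nseq /= !eqSS val_eqE (negPf ji).
pose g f := sort geq (nseq (n - sumn (u f)) 1 ++ u f).
have -> : N.+1 ^ K = size (enum {: {ffun 'I_K -> 'I_N.+1}}).
  by rewrite -cardT card_ffun !card_ord.
apply: (@leq_size_in _ _ g); first exact: enum_uniq.
  move=> f h _ _ gfh; apply/ffunP => i; apply: val_inj => /=.
  have : count_mem i.+2 (g f) = count_mem i.+2 (g h) by rewrite gfh.
  rewrite !(permP (permEl (perm_sort _ _))) !count_cat !count_nseq !count_u /=.
  by rewrite !add0n.
move=> f _; have -> : n = sumn (nseq (n - sumn (u f)) 1 ++ u f).
  by rewrite sumn_cat sumn_nseq mul1n subnK.
by apply: sort_partition; rewrite all_cat u_gt0 all_nseq orbT.
Qed.

Lemma npart_superpoly (e : nat) : exists C, forall n, n.+1 ^ e.+1 <= C * npart n.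
Proof.
exists ((e.+1 * e.+2) ^ e.+1) => n.
apply: (@leq_trans ((e.+1 * e.+2 * (n %/ (e.+1 * e.+2)).+1) ^ e.+1)).
  by rewrite leq_exp2r // mulnC ltn_ceil.
by rewrite expnMn leq_mul // npart_ge_exp // mulnC leq_trunc_div.
Qed.

Lemma npart_dominates_exp (k e : nat) :
  exists n0, forall n, n0 <= n -> k * n.+1 ^ e <= npart n.
Proof.
have [C CP] := npart_superpoly e; exists (C * k) => n n0.
have C0 : 0 < C.
  by rewrite lt0n; apply: contraTN (CP n) => /eqP ->; rewrite leqn0 expn_eq0.
rewrite -(leq_pmul2l C0); apply: leq_trans (CP n).
by rewrite mulnA expnS leq_mul // ltnW.
Qed.

(** With [L = 2 k] in [dpart_bound], the polynomial term is eventually at most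
    [npart n], so that [2 k * dpart n <= 2 * npart n]. *)
Lemma npart_dominates_dpart (k : nat) :
  exists n0, forall n, n0 <= n -> k * dpart n <= npart n.
Proof.
have [n0 n0P] := npart_dominates_exp (2 * k) (2 * (2 * k)).
exists n0 => n /n0P hn; have := dpart_bound (2 * k) n; lia.
Qed.

(** * Counting partitions by their mex *)

Local Arguments mex : simpl never.

Fixpoint stair (s m : nat) : seq nat :=
  if m is m'.+1 then nseq s m ++ stair s m' else [::].

Lemma sumn_stair (s m : nat) : sumn (stair s m) = s * 'C(m.+1, 2).
Proof.
elim: m => [|m IHm]; first by rewrite muln0.
by rewrite /= sumn_cat IHm sumn_nseq (binS m.+1) bin1 mulnDr addnC (mulnC m.+1).
Qed.

Lemma stair_gt0 (s m : nat) : all (fun k => 0 < k) (stair s m).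
Proof. by elim: m => //= m IHm; rewrite all_cat IHm all_nseq orbT. Qed.

Lemma count_stair (s m k : nat) :
  count_mem k (stair s m) = if 0 < k <= m then s else 0.
Proof.
elim: m => [|m IHm] /=; first by case: k.
rewrite count_cat IHm count_nseq /= eq_sym.
have [->|km] := eqVneq k m.+1; first by rewrite leqnn ltnn mul1n addn0.
by rewrite mul0n [k <= m.+1]leq_eqVlt (negPf km) ltnS.
Qed.

(** This turns the mex into a containment of multisets, to which
    [count_contains] applies. *)
Lemma contains_stair (s m : nat) (p : seq nat) : 0 < s ->
  contains (stair s m) p = (m < mex s p).
Proof.
move=> s0; have [_ mex_lt mex_min] := mexP p s0.
apply/containsP/idP => [h|mm k]; last first.
  rewrite count_stair; case: ifP => // /andP[k0 km]; rewrite leqNgt.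
  by apply/negP => /(mex_min _ k0); rewrite leqNgt (leq_ltn_trans km).
rewrite ltnNge; apply/negP => mexm; move: (h (mex s p)).
by rewrite count_stair mexm /= leqNgt mex_lt.
Qed.

Definition nmex (s n m : nat) : nat := count (fun p => mex s p == m) (partitions n).

Lemma nmexE (s n m : nat) : 0 < s ->
  nmex s n m.+1 =
    (if s * 'C(m.+1, 2) <= n then npart (n - s * 'C(m.+1, 2)) else 0) -
    (if s * 'C(m.+2, 2) <= n then npart (n - s * 'C(m.+2, 2)) else 0).
Proof.
move=> s0.
have tailE j :
    (if s * 'C(j.+1, 2) <= n then npart (n - s * 'C(j.+1, 2)) else 0) =
    count (fun p => j < mex s p) (partitions n).
  rewrite -sumn_stair -count_contains ?stair_gt0 //.
  by apply: eq_count => p; rewrite contains_stair.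
rewrite !tailE.
have := count_predC (fun p => m.+1 < mex s p) [seq p <- partitions n | m < mex s p].
rewrite size_filter count_filter [X in _ + X]count_filter => <-.
rewrite (eq_count (a2 := fun p => m.+1 < mex s p)) ?addKn; last first.
  by move=> p /=; apply: andb_idr; exact: ltnW.
by apply: eq_count => p /=; rewrite -leqNgt eqn_leq.
Qed.

(** The formula [nmexE] with the tests dropped, so that truncated subtraction
    reads p as the constant p(0) = 1 at negative arguments.  That extension of
    p is convex, unlike the extension by 0, which jumps at 0; the two
    formulas differ by 1 for the single [m] whose block contains [n]. *)
Definition nmex_trunc (s n m : nat) : nat :=
  npart (n - s * 'C(m, 2)) - npart (n - s * 'C(m.+1, 2)).

Lemma nmex_trunc_le (s n m : nat) : 0 < s -> 0 < m -> nmex_trunc s n m <= nmex s n m.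
Proof.
case: m => // m s0 _; rewrite nmexE // /nmex_trunc.
have le1 : s * 'C(m.+1, 2) <= s * 'C(m.+2, 2).
  by rewrite leq_mul2l binS leq_addr orbT.
move: (s * _) (s * _) le1 => x y yx.
case: (leqP x n) => h2; first by rewrite (leq_trans yx h2).
case: (leqP y n) => h1; first by rewrite subn0 leq_subr.
rewrite (eqP (ltnW h1 : n - y == 0)) (eqP (ltnW h2 : n - x == 0)).
by rewrite subnn.
Qed.

Lemma nmex_le_trunc (s n m : nat) : 0 < s -> 0 < m ->
  nmex s n m <= nmex_trunc s n m + (m <= n.+1).
Proof.
case: m => // m s0 _; rewrite nmexE // /nmex_trunc.
have le1 : s * 'C(m.+1, 2) <= s * 'C(m.+2, 2).
  by rewrite leq_mul2l binS leq_addr orbT.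
have le2 : m <= s * 'C(m.+1, 2).
  by rewrite binS bin1 (leq_trans _ (leq_pmull _ s0)) ?leq_addl.
move: (s * _) (s * _) le1 le2 => x y yx my.
case: (leqP x n) => h2; first by rewrite (leq_trans yx h2) leq_addr.
case: (leqP y n) => h1; last by rewrite sub0n.
rewrite (eqP (ltnW h2 : n - x == 0)) subn0 ltnS (leq_trans my h1) -leq_subLR.
have : npart 0 <= 1 by rewrite npart0.
lia.
Qed.

(** The average increase of p over the block of [b] is at most that over the
    block of [a], since the former lies below the latter and p is convex.  The
    increment at the common bound [n - s * 'C(b, 2)] separates the two. *)
Lemma nmex_trunc_ratio (s n a b : nat) :
  a < b -> a * nmex_trunc s n b <= b * nmex_trunc s n a.
Proof.
move=> ab.
have step m : n - s * 'C(m.+1, 2) = n - s * 'C(m, 2) - s * m.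
  by rewrite binS bin1 mulnDr subnDA.
have le1 : s * 'C(a.+1, 2) <= s * 'C(b, 2) by rewrite leq_mul2l leq_bin2l ?orbT.
rewrite /nmex_trunc !step.
have h1 := @npart_sub_le (n - s * 'C(b, 2)) (s * b) _ (leqnn _).
have h2 := @npart_sub_ge (n - s * 'C(a, 2)) (s * a) (n - s * 'C(b, 2)).
rewrite -step in h2; have {}h2 := h2 (leq_sub2l _ le1).
apply: leq_trans (leq_mul (leqnn a) h1) _.
rewrite -step; apply: leq_trans (leq_mul (leqnn b) h2).
by apply: eq_leq; lia.
Qed.

Lemma nmex_trunc_le_dpart (s n m : nat) : nmex_trunc s n m <= s * m * dpart n.
Proof.
rewrite /nmex_trunc binS bin1 mulnDr subnDA; apply: npart_sub_le; exact: leq_subr.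
Qed.

(** * Comparison of two residue classes *)

Lemma mex_le (s n : nat) (p : seq nat) :
  0 < s -> p \in partitions n -> mex s p <= n.+1.
Proof.
move=> s0; rewrite mem_partitions => /and3P[_ _ /eqP sp].
have [_ _ mex_min] := mexP p s0; apply: mex_min => //.
rewrite (count_memPn _) //; apply/negP => /mem_le_sumn.
by rewrite sp ltnn.
Qed.

(** The mex is positive and at most [n.+1], so every mex in the class of [A]
    has the form [A + j * M] with [j <= n]. *)
Lemma sigmaE (M A s r n : nat) : 0 < A <= M -> 0 < s ->
  sigma M A s r n = \sum_(j < n.+1) (A + j * M) ^ r * nmex s n (A + j * M).
Proof.
move=> /andP[A0 AM] s0; have M0 := leq_trans A0 AM.
under [RHS]eq_bigr => j _ do rewrite /nmex -sum1_count big_distrr big_mkcond /=.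
rewrite exchange_big /sigma big_mkcond /=; apply: eq_big_seq => p pn.
have [m0 _ _] := mexP p s0; have := mex_le s0 pn.
move: (mex s p) m0 => m m0 mn.
case: eqP => mA; last first.
  rewrite big1 // => j _; case: eqP => // mE; case: mA.
  by rewrite mE addnC modnMDl.
have Am : A <= m.
  rewrite leqNgt; apply/negP => mA'.
  have : M %| A - m by rewrite -eqn_mod_dvd ?(ltnW mA') // mA.
  by rewrite gtnNdvd ?subn_gt0 // ltn_subLR ?(ltnW mA') //; lia.
have /dvdnP[j mE] : M %| m - A by rewrite -eqn_mod_dvd // mA.
have {}mE : m = A + j * M by rewrite -mE subnKC.
have jn : j < n.+1.
  by apply: leq_trans mn; rewrite mE -add1n leq_add // leq_pmulr.
rewrite (bigD1 (Ordinal jn)) //= -mE eqxx muln1 big1 ?addn0 // => i ij.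
case: eqP => // mE'; case/negP: ij; rewrite -val_eqE /=.
by move: mE'; rewrite mE => /addnI/eqP; rewrite eqn_pmul2r // eq_sym.
Qed.

Lemma npart_le_sum_sigma (M s r n : nat) : 0 < M -> 0 < s ->
  npart n <= \sum_(i < M) sigma M i.+1 s r n.
Proof.
move=> M0 s0; rewrite /sigma.
under eq_bigr do rewrite big_mkcond /=.
rewrite exchange_big /npart -sum1_size; apply: leq_sum => p _ /=.
have [m0 _ _] := mexP p s0.
have iM : (mex s p).-1 %% M < M by rewrite ltn_mod.
have iE : mex s p = ((mex s p).-1 %% M).+1 %[mod M].
  by rewrite -[in RHS]addn1 modnDml addn1 prednK.
rewrite (bigD1 (Ordinal iM)) //= -iE eqxx.
by rewrite ltn_addr // expn_gt0 m0.
Qed.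

(** The estimate (a + c)^e <= a^e + C a^(e-1), multiplied by [a] to avoid the
    exponent [e - 1]. *)
Lemma expn_shift (c e : nat) :
  exists C, forall a, 0 < a -> a * (a + c) ^ e <= a ^ e.+1 + C * a ^ e.
Proof.
elim: e => [|e [C CP]].
  by exists 0 => a _; rewrite !expn0 muln1 expn1 mul0n addn0.
exists (C + c + c * C) => a a0.
rewrite expnS mulnCA; apply: leq_trans (leq_mul (leqnn (a + c)) (CP a a0)) _.
rewrite (expnS a e.+1) !(expnS a e).
have : c * C * a ^ e <= c * C * (a * a ^ e) by rewrite leq_mul2l leq_pmull ?orbT.
nia.
Qed.

(** The ratio ((a + c) / a)^e tends to 1 as [a] grows. *)
Lemma expn_shift_ratio (c e k : nat) :
  exists a0, forall a, a0 <= a -> k * (a + c) ^ e <= k.+1 * a ^ e.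
Proof.
have [C CP] := expn_shift c e; exists (k * C).+1 => a aP.
have a0 : 0 < a by exact: leq_trans aP.
rewrite -(leq_pmul2l a0) mulnCA.
apply: leq_trans (leq_mul (leqnn k) (CP a a0)) _.
rewrite expnS mulnDr mulSn mulnDr addnC leq_add //; last by rewrite mulnCA.
by rewrite mulnA leq_mul // ltnW.
Qed.

(** Of the factor [b ^ r.+1], the power [b ^ r] is the weight and the last [b]
    comes from [nmex_trunc_ratio]. *)
Lemma weighted_nmex_ratio (s r k n a b : nat) : 0 < a < b ->
  k * b ^ r.+1 <= k.+1 * a ^ r.+1 ->
  k * (b ^ r * nmex_trunc s n b) <= k.+1 * (a ^ r * nmex_trunc s n a).
Proof.
move=> /andP[a0 ab] kab; have := nmex_trunc_ratio s n ab.
move: (nmex_trunc s n a) (nmex_trunc s n b) => x y xy.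
have ar0 : 0 < a ^ r.+1 by rewrite expn_gt0 a0.
rewrite -(leq_pmul2l ar0).
apply: (@leq_trans (k * a ^ r * b ^ r * (b * x))).
  rewrite expnS; have := leq_mul (leqnn (k * a ^ r * b ^ r)) xy; lia.
have := leq_mul kab (leqnn (a ^ r * x)); rewrite (expnS b); lia.
Qed.

(** Term [A + j * M] of the first sum is compared with term [B + j.+1 * M] of
    the second, which is larger by at most [2 * M] whatever the order of [A]
    and [B].  The shift leaves out the term [B] of the second sum. *)
Lemma sigma_compare (M s r k : nat) : 0 < s ->
  exists C, forall A B n, 0 < A <= M -> 0 < B <= M ->
    k * sigma M B s r n <= k.+1 * sigma M A s r n + C * (dpart n + n.+1 ^ r.+1).
Proof.
move=> s0; have [J JP] := expn_shift_ratio (2 * M) r.+1 k.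
(* [W * dpart n] bounds each of the terms that are not compared: the first one
   and those paired with [j < J]; their indices are at most [M + J * M + M]. *)
pose W := k * ((M + J * M + M) ^ r * (s * (M + J * M + M))).
exists (J * W + W + k) => A B n hA hB; rewrite !sigmaE //.
have /andP[A0 AM] := hA; have /andP[B0 BM] := hB.
pose F m := m ^ r * nmex_trunc s n m.
have FW m : m <= M + J * M + M -> k * F m <= W * dpart n.
  move=> mb; rewrite /W -mulnA leq_mul2l; apply/orP; right.
  rewrite -mulnA; apply: leq_mul; first by case: (r) => // r'; rewrite leq_exp2r.
  apply: leq_trans (nmex_trunc_le_dpart s n m) _.
  by rewrite leq_mul // leq_mul.
(* The boundary corrections are at most 1 and occur only for [m <= n.+1]. *)
have upper : \sum_(j < n.+1) (B + j * M) ^ r * nmex s n (B + j * M) <=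
    \sum_(j < n.+1) F (B + j * M) + n.+1 ^ r.+1.
  rewrite [n.+1 ^ r.+1]expnS -[X in X * _ ^ r]card_ord -sum_nat_const -big_split /=.
  apply: leq_sum => j _; set m := B + j * M.
  have m0 : 0 < m by rewrite addn_gt0 B0.
  apply: leq_trans (leq_mul (leqnn _) (nmex_le_trunc n s0 m0)) _.
  rewrite mulnDr leq_add2l; case: (leqP m n.+1) => mn; last by rewrite muln0.
  rewrite muln1.
  by case: (r) => // r'; rewrite leq_exp2r.
have lower : \sum_(j < n) F (A + j * M) <=
    \sum_(j < n.+1) (A + j * M) ^ r * nmex s n (A + j * M).
  rewrite big_ord_recr /=; apply: leq_trans (leq_addr _ _).
  apply: leq_sum => j _; rewrite leq_mul // nmex_trunc_le //.
  by rewrite addn_gt0 A0.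
have term j : k * F (B + j.+1 * M) <= k.+1 * F (A + j * M) + (j < J) * (W * dpart n).
  have [jJ|Jj] := ltnP j J.
    rewrite mul1n; apply: leq_trans (leq_addl _ _); apply: FW.
    by rewrite mulSnr addnA leq_add2r leq_add // leq_mul2r (ltnW jJ) orbT.
  rewrite mul0n addn0; apply: weighted_nmex_ratio; first by lia.
  have aJ : J <= A + j * M by apply: leq_trans Jj _; nia.
  apply: leq_trans (JP _ aJ); rewrite leq_mul2l leq_exp2r //; apply/orP; right; lia.
have count_J m : \sum_(j < m) (j < J) * (W * dpart n) <= J * (W * dpart n).
  rewrite -big_distrl leq_mul2r /=; apply/orP; right.
  have : \sum_(j < m) (j < J) <= minn m J.
    elim: m => [|m IHm]; first by rewrite big_ord0.
    rewrite big_ord_recr; apply: leq_trans (leq_add IHm (leqnn _)) _ => /=.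
    by case: ltnP; lia.
  by move=> /leq_trans; apply; exact: geq_minr.
have main : k * \sum_(j < n.+1) F (B + j * M) <=
    k.+1 * \sum_(j < n) F (A + j * M) + (J * W + W) * dpart n.
  rewrite big_ord_recl mulnDr mul0n addn0.
  have : \sum_(j < n) k * F (B + j.+1 * M) <=
      \sum_(j < n) (k.+1 * F (A + j * M) + (j < J) * (W * dpart n)).
    by apply: leq_sum => j _; exact: term.
  rewrite big_split -[X in X <= _]big_distrr /= => h.
  have FB : k * F B <= W * dpart n by apply: FW; lia.
  apply: leq_trans (leq_add FB h) _; rewrite addnC -addnA big_distrr leq_add2l.
  rewrite mulnDl -mulnA leq_add2r; exact: count_J.
have := leq_mul (leqnn k) upper; have := leq_mul (leqnn k.+1) lower.
lia.
Qed.

Lemma npart_dominates_error (r k : nat) :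
  exists n0, forall n, n0 <= n -> k * (dpart n + n.+1 ^ r) <= npart n.
Proof.
have [n1 P1] := npart_dominates_dpart (2 * k).
have [n2 P2] := npart_dominates_exp (2 * k) r.
exists (maxn n1 n2) => n; rewrite geq_max => /andP[/P1 h1 /P2 h2]; lia.
Qed.

(** By [sigma_compare] with [k = 1], all the sums over residue classes are of
    the same order up to the error, and together they are at least [npart n],
    which dominates the error. *)
Lemma sigma_dominates_error (M A s r k : nat) : 0 < A <= M -> 0 < s ->
  exists n0, forall n, n0 <= n ->
    k * (dpart n + n.+1 ^ r.+1) <= sigma M A s r n.
Proof.
move=> hA s0; have [C CP] := sigma_compare M r 1 s0.
have M0 : 0 < M by case/andP: hA; exact: leq_trans.
have [n0 n0P] := npart_dominates_error r.+1 (M * C + M * (2 * k)).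
exists n0 => n /n0P; move: (dpart n + _) (fun B => CP A B n hA) => E CPn hE.
have := leq_trans hE (npart_le_sum_sigma r n M0 s0).
have : \sum_(i < M) sigma M i.+1 s r n <= M * (2 * sigma M A s r n + C * E).
  rewrite -[X in X * _]card_ord -sum_nat_const; apply: leq_sum => i _.
  by rewrite -[X in X <= _]mul1n; apply: CPn; rewrite ltn_ord.
move=> h1 /leq_trans/(_ h1); rewrite mulnDr mulnDl.
rewrite [M * (C * E)]mulnA addnC leq_add2r.
by rewrite -!mulnA !leq_pmul2l.
Qed.

Lemma sigma_eventually_le (M A B s r k : nat) :
  0 < A <= M -> 0 < B <= M -> 0 < s ->
  exists n0, forall n, n0 <= n ->
    k * sigma M B s r n <= k.+2 * sigma M A s r n.
Proof.
move=> hA hB s0; have [C CP] := sigma_compare M r k s0.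
have [n0 n0P] := sigma_dominates_error r C hA s0.
exists n0 => n /n0P h; have := CP A B n hA hB; lia.
Qed.

(** * The limit *)

Local Open Scope classical_set_scope.
Local Open Scope ring_scope.

Theorem corollary1p5 (R : realType) (A A' M r s : nat)
    (hA : (0 < A <= M)%N) (hA' : (0 < A' <= M)%N) (hs : (0 < s)%N) :
  (fun n : nat => (sigma M A s r n)%:R / (sigma M A' s r n)%:R : R) @ \oo
    --> (1 : R).
Proof.
apply/cvgrPdist_le => e e0.
(* The integer inequalities for [k.+1] put the ratio within 2 / [k.+1] of 1. *)
have [k ke] : exists k : nat, 2 / e <= k.+1%:R.
  exists (Num.truncn (2 / e)).
  by apply/ltW; rewrite truncnS_gt.
have [n1 P1] := sigma_eventually_le r k.+1 hA hA' hs.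
have [n2 P2] := sigma_eventually_le r k.+1 hA' hA hs.
have [n3 P3] := sigma_dominates_error r 1 hA' hs.
exists (maxn n1 (maxn n2 n3)) => // n /=; rewrite !geq_max.
move=> /and3P[/P1 + /P2 + /P3 h3].
have : (0 < sigma M A' s r n)%N.
  by apply: leq_trans h3; rewrite mul1n ltn_addl // expn_gt0.
move: (sigma M A' s r n) (sigma M A s r n) => y x y0 h1 h2.
have yR : (0 : R) < y%:R by rewrite ltr0n.
have {}h1 : (k.+1%:R * y%:R <= (k.+1%:R + 2) * x%:R :> R).
  by rewrite -natrD -!natrM ler_nat addn2.
have {}h2 : (k.+1%:R * x%:R <= (k.+1%:R + 2) * y%:R :> R).
  by rewrite -natrD -!natrM ler_nat addn2.
have K0 : (0 : R) < k.+1%:R by rewrite ltr0n.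
rewrite ler_pdivrMr // in ke.
move: (k.+1%:R : R) (x%:R : R) (y%:R : R) ke h1 h2 yR K0 => K u v ke h1 h2 v0 K0.
have -> : 1 - u / v = (v - u) / v by field; rewrite gt_eqF.
rewrite normrM normfV (gtr0_norm v0) ler_pdivrMr // ler_norml.
by apply/andP; split; nra.
Qed.
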